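(* For every integer $n\ge2$, set $$X_n=\left(-n,-\frac1n;1,-1\right),\qquad Y=(-1,1;\infty,0).$$ Then $$\mathrm{cr}_q(X_n)=\mathrm{cr}_q(Y)=-q.$$ Moreover, the quadruples $Y,X_2,X_3,\ldots$ are pairwise non-equivalent even under the joint action of $\mathrm{PGL}(2,\mathbb Z)$ and the full symmetric group $S_4$.
   Context: $\mathrm{PGL}(2,\mathbb Z)=\mathrm{GL}(2,\mathbb Z)/\{\pm1\}$ acts on ordered quadruples of points of $\mathbb P^1(\mathbb Q)=\mathbb Q\cup\{\infty\}$ by simultaneous fractional-linear transformations; $S_4$ acts by permuting the four positions. **$q$-rationals.** $[\,\cdot\,]_q:\mathbb P^1(\mathbb Q)\to\mathbb P^1(\mathbb Q(q))$ is the unique map with $[0]_q=0$, $[x+1]_q=q[x]_q+1$ and $[-1/x]_q=-1/(q[x]_q)$ for all $x$ (usual conventions for $\infty$; in particular $[\infty]_q=\infty$). **Cross-ratios.** For pairwise distinct points of $\mathbb P^1(\mathbb K)$ with nonzero lifts $X_i\in\mathbb K^2$ and $\Delta_{ij}=\det(X_i,X_j)$, $\mathrm{cr}(x_1,x_2;x_3,x_4)=\frac{\Delta_{13}\Delta_{24}}{\Delta_{14}\Delta_{23}}$ (equal to $\frac{(x_1-x_3)(x_2-x_4)}{(x_1-x_4)(x_2-x_3)}$ in finite affine coordinates). For pairwise distinct $x_i\in\mathbb P^1(\mathbb Q)$, $\mathrm{cr}_q(x_1,x_2;x_3,x_4)=\mathrm{cr}([x_1]_q,[x_2]_q;[x_3]_q,[x_4]_q)\in\mathbb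 Q(q)$. *)

(* Defs.v *)
From HB Require Import structures.
From mathcomp Require Import all_boot all_order all_algebra all_fingroup.
From mathcomp Require Import ring lra zify.

Set Implicit Arguments.
Unset Strict Implicit.
Unset Printing Implicit Defensive.

Import Order.TTheory GRing.Theory Num.Theory.
Local Open Scope ring_scope.

Definition P1 (K : fieldType) : Type := option K.

Notation infty := (@None _).
Notation fin x := (@Some _ x).

Definition mx2 (R : nzRingType) (a b c d : R) : 'M[R]_2 :=
  \matrix_(i, j) if i == 0 then (if j == 0 then a else b)
                 else (if j == 0 then c else d).

Definition vec2 (R : nzRingType) (a b : R) : 'cV[R]_2 :=
  \col_i (if i == 0 then a else b).

Definition lift_pt (K : fieldType) (x : P1 K) : 'cV[K]_2 :=
  match x with fin a => vec2 a 1 | infty => vec2 1 0 end.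

(* Only meaningful for nonzero [v]. *)
Definition pt_of (K : fieldType) (v : 'cV[K]_2) : P1 K :=
  if v 1 0 == 0 then infty else fin (v 0 0 / v 1 0).

(* Only meaningful for invertible [A]. *)
Definition moebius (K : fieldType) (A : 'M[K]_2) (x : P1 K) : P1 K :=
  pt_of (A *m lift_pt x).

Definition Delta (K : fieldType) (u v : 'cV[K]_2) : K := \det (row_mx u v).

(* Only meaningful for pairwise distinct points: [y / 0 = 0] otherwise. *)
Definition cr (K : fieldType) (x1 x2 x3 x4 : P1 K) : K :=
  let D x y := Delta (lift_pt x) (lift_pt y) in
  (D x1 x3 * D x2 x4) / (D x1 x4 * D x2 x3).

Section Moebius.
Variable K : fieldType.
Implicit Types (x : P1 K) (u v : 'cV[K]_2) (A B : 'M[K]_2).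

Lemma vecP u v : u 0 0 = v 0 0 -> u 1 0 = v 1 0 -> u = v.
Proof.
move=> h0 h1; apply/matrixP => i j; rewrite ord1 {j}.
by case: i => [[|[|//]] hi]; [have -> : Ordinal hi = 0 by exact: val_inj
  | have -> : Ordinal hi = 1 by exact: val_inj].
Qed.

Lemma vec2E0 (a b : K) : vec2 a b 0 0 = a. Proof. by rewrite mxE. Qed.
Lemma vec2E1 (a b : K) : vec2 a b 1 0 = b. Proof. by rewrite mxE. Qed.

Lemma lift_pt_neq0 x : lift_pt x != 0.
Proof.
case: x => [a|]; apply/eqP => /matrixP h.
  by have /eqP := h 1 0; rewrite !mxE /= oner_eq0.
by have /eqP := h 0 0; rewrite !mxE /= oner_eq0.
Qed.

Lemma lift_ptK x : pt_of (lift_pt x) = x.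
Proof.
by case: x => [a|]; rewrite /pt_of vec2E1 ?eqxx // oner_eq0 vec2E0 divr1.
Qed.

Lemma lift_pt_of v : v != 0 -> exists2 c, c != 0 & v = c *: lift_pt (pt_of v).
Proof.
move=> v0; rewrite /pt_of; case: eqP => [h1|/eqP h1].
  have h0 : v 0 0 != 0.
    by apply: contra_neq v0 => h0; apply: vecP; rewrite mxE.
  by exists (v 0 0) => //; apply: vecP; rewrite !mxE /= ?mulr1 ?mulr0.
exists (v 1 0) => //; apply: vecP; rewrite !mxE /= ?mulr1 //.
by rewrite mulrC divfK.
Qed.

Lemma pt_ofZ c v : c != 0 -> pt_of (c *: v) = pt_of v.
Proof.
by move=> c0; rewrite /pt_of !mxE mulf_eq0 (negPf c0) /= -mulf_div divff // mul1r.
Qed.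

Lemma det_mx2 (A : 'M[K]_2) : \det A = A 0 0 * A 1 1 - A 0 1 * A 1 0.
Proof.
rewrite (expand_det_row _ 0) !big_ord_recl big_ord0 addr0 /cofactor !det_mx11.
rewrite !mxE /= expr0 expr1 mul1r mulN1r mulrN.
by do !congr (_ + _); do ?congr (- _); congr (_ * _);
  congr (A _ _); apply: val_inj.
Qed.

Lemma DeltaE u v : Delta u v = u 0 0 * v 1 0 - u 1 0 * v 0 0.
Proof.
have e0 i : row_mx u v i 0 = u i 0.
  by rewrite -(row_mxEl u v i 0); congr (row_mx u v _ _); apply: val_inj.
have e1 i : row_mx u v i 1 = v i 0.
  by rewrite -(row_mxEr u v i 0); congr (row_mx u v _ _); apply: val_inj.
by rewrite /Delta det_mx2 !e0 !e1 [v 0 0 * _]mulrC.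
Qed.

(* The cross-ratio does not depend on the choice of nonzero lifts. *)
Lemma cr_lift (u1 u2 u3 u4 : 'cV[K]_2) :
  u1 != 0 -> u2 != 0 -> u3 != 0 -> u4 != 0 ->
  cr (pt_of u1) (pt_of u2) (pt_of u3) (pt_of u4) =
  (Delta u1 u3 * Delta u2 u4) / (Delta u1 u4 * Delta u2 u3).
Proof.
move=> /lift_pt_of[c1 n1 e1] /lift_pt_of[c2 n2 e2].
move=> /lift_pt_of[c3 n3 e3] /lift_pt_of[c4 n4 e4].
have DZ a b u v : Delta (a *: u) (b *: v) = a * b * Delta u v.
  by rewrite !DeltaE !mxE; ring.
pose D (x y : P1 K) := Delta (lift_pt x) (lift_pt y).
have DD a b u v (x y : P1 K) : u = a *: lift_pt x -> v = b *: lift_pt y ->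
    Delta u v = a * b * D x y by move=> -> ->; apply: DZ.
rewrite (DD _ _ _ _ _ _ e1 e3) (DD _ _ _ _ _ _ e2 e4).
rewrite (DD _ _ _ _ _ _ e1 e4) (DD _ _ _ _ _ _ e2 e3).
rewrite [c1 * _ * _ * _]mulrACA [c1 * c4 * _ * _]mulrACA.
have -> : c1 * c4 * (c2 * c3) = c1 * c3 * (c2 * c4) by ring.
by rewrite -[RHS]mulf_div divff ?mul1r // !mulf_neq0.
Qed.

Lemma moebiusM A B x : B \in unitmx ->
  moebius A (moebius B x) = moebius (A *m B) x.
Proof.
move=> uB; have nz : B *m lift_pt x != 0.
  apply: contra_neq (lift_pt_neq0 x) => h.
  by rewrite -(mulKmx uB (lift_pt x)) h mulmx0.
have [c c0 e] := lift_pt_of nz.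
by rewrite /moebius -mulmxA [in RHS]e -scalemxAr pt_ofZ.
Qed.

Lemma moebius_inj A : A \in unitmx -> injective (moebius A).
Proof.
move=> uA x y /(congr1 (moebius (invmx A))).
by rewrite !moebiusM // mulVmx // /moebius !mul1mx !lift_ptK.
Qed.

Lemma moebiusZ c A x : c != 0 -> moebius (c *: A) x = moebius A x.
Proof. by move=> c0; rewrite /moebius -scalemxAl pt_ofZ. Qed.

Lemma mx2M (a b c d a' b' c' d' : K) : mx2 a b c d *m mx2 a' b' c' d' =
  mx2 (a * a' + b * c') (a * b' + b * d') (c * a' + d * c') (c * b' + d * d').
Proof.
apply/matrixP => i j; rewrite !mxE !big_ord_recl big_ord0 addr0 !mxE /=.
by case: ifP => _; case: ifP.
Qed.

Lemma mx2Z (k a b c d : K) :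
  k *: mx2 a b c d = mx2 (k * a) (k * b) (k * c) (k * d).
Proof. by apply/matrixP => i j; rewrite !mxE; do 2!case: ifP. Qed.

Lemma mx2_unit (a b c d : K) : (a * d - b * c != 0) -> mx2 a b c d \in unitmx.
Proof. by move=> h; rewrite unitmxE unitfE det_mx2 !mxE. Qed.

Lemma moebius_fin (a b c d x : K) : c * x + d != 0 ->
  moebius (mx2 a b c d) (fin x) = fin ((a * x + b) / (c * x + d)).
Proof.
move=> h; rewrite /moebius /pt_of !mxE !big_ord_recl !big_ord0 !mxE /=.
by rewrite !mulr1 !addr0 (negPf h).
Qed.

Lemma moebius_pole (a b c d x : K) : c * x + d = 0 ->
  moebius (mx2 a b c d) (fin x) = infty.
Proof.
move=> h; rewrite /moebius /pt_of !mxE !big_ord_recl !big_ord0 !mxE /=.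
by rewrite !mulr1 !addr0 h eqxx.
Qed.

Lemma moebius_inf (a b c d : K) :
  moebius (mx2 a b c d) infty = if c == 0 then infty else fin (a / c).
Proof.
rewrite /moebius /pt_of !mxE !big_ord_recl !big_ord0 !mxE /=.
by rewrite !mulr1 !mulr0 !addr0.
Qed.

End Moebius.

Record is_qrational (K : fieldType) (q : K) (f : P1 rat -> P1 K) : Prop := IsQRational {
  qrational0 : f (fin 0) = fin 0;
  (* [x + 1]_q = q [x]_q + 1 *)
  qrationalT : forall x,
    f (moebius (mx2 1 1 0 1) x) = moebius (mx2 q 1 0 1) (f x);
  (* [- 1 / x]_q = - 1 / (q [x]_q) *)
  qrationalS : forall x,
    f (moebius (mx2 0 (- 1) 1 0) x) = moebius (mx2 0 (- 1) q 0) (f x) }.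

Section QRational.

Variables (K : fieldType) (q : K).
Hypothesis q_neq0 : q != 0.

Let T : 'M[rat]_2 := mx2 1 1 0 1.
Let S : 'M[rat]_2 := mx2 0 (- 1) 1 0.
Let Tq : 'M[K]_2 := mx2 q 1 0 1.
Let Sq : 'M[K]_2 := mx2 0 (- 1) q 0.
Let Lq : 'M[K]_2 := mx2 q 0 q 1.

Let uTq : Tq \in unitmx.
Proof. by apply: mx2_unit; rewrite mulr1 mulr0 subr0 q_neq0. Qed.
Let uSq : Sq \in unitmx.
Proof. by apply: mx2_unit; rewrite mul0r mulN1r sub0r opprK q_neq0. Qed.
Let uLq : Lq \in unitmx.
Proof. by apply: mx2_unit; rewrite mulr1 mul0r subr0 q_neq0. Qed.

Let SqK x : moebius Sq (moebius Sq x) = x.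
Proof.
rewrite moebiusM // mx2M; have -> : mx2 (0 * 0 + - 1 * q) (0 * -1 + -1 * 0)
   (q * 0 + 0 * q) (q * -1 + 0 * 0) = (- q) *: mx2 1 0 0 1 :> 'M[K]_2.
  by rewrite mx2Z; congr mx2; ring.
rewrite moebiusZ ?oppr_eq0 ?q_neq0 //.
have -> : mx2 1 0 0 1 = 1%:M :> 'M[K]_2.
  apply/matrixP => i j; rewrite !mxE.
  by case: i => [[|[|//]] ?]; case: j => [[|[|//]] ?].
by rewrite /moebius mul1mx lift_ptK.
Qed.

(* The value at the nonnegative rational [a / b], computed by the subtractive
   Euclidean algorithm with fuel [n]. *)
Fixpoint qeuclid (n a b : nat) : P1 K :=
  if n is m.+1 then
    if a == 0%N then fin 0 else if b == 0%N then infty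
    else if (b <= a)%N then moebius Tq (qeuclid m (a - b) b)
    else moebius Lq (qeuclid m a (b - a))
  else fin 0.

Let qeuclidS m a b : qeuclid m.+1 a b =
  if a == 0%N then fin 0 else if b == 0%N then infty
  else if (b <= a)%N then moebius Tq (qeuclid m (a - b) b)
  else moebius Lq (qeuclid m a (b - a)).
Proof. by []. Qed.

Let F a b := qeuclid (a + b) a b.

Let qeuclidE n a b : (a + b <= n)%N -> qeuclid n a b = F a b.
Proof.
rewrite /F; move: {2}(a + b)%N (leqnn (a + b)) => k.
elim: k n a b => [|k IH] [|n] a b hk hn //=.
- by have [-> ->] : a = 0%N /\ b = 0%N by lia.
- by have [-> ->] : a = 0%N /\ b = 0%N by lia.
- by have [-> ->] : a = 0%N /\ b = 0%N by lia.
have [->|a0] := eqVneq a 0%N; first by rewrite add0n; case: (b).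
have [->|b0] := eqVneq b 0%N.
  by rewrite addn0; case: (a) a0.
case e: (a + b)%N => [|m] /=; first by lia.
rewrite (negPf a0) (negPf b0); case: leqP => h; congr moebius.
  by rewrite (IH n) ?(IH m) //; lia.
by rewrite (IH n) ?(IH m) //; lia.
Qed.

Let F0 b : F 0 b = fin 0.
Proof. by rewrite /F; case: b. Qed.
Let Finf a : (0 < a)%N -> F a 0 = infty.
Proof. by rewrite /F addn0; case: a. Qed.
Let FT a b : (0 < b)%N -> F (a + b) b = moebius Tq (F a b).
Proof.
move=> b0; rewrite {1}/F; case e: (a + b + b)%N => [|m]; first by lia.
rewrite /= !gtn_eqF ?leq_addl ?addnK ?qeuclidE //; lia.
Qed.
Let FL a b : (0 < a)%N -> F a (b + a) = moebius Lq (F a b).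
Proof.
case: b => [|b] a0.
  rewrite add0n -{1}[a]add0n FT // F0 Finf // moebius_inf (negPf q_neq0).
  by rewrite divff ?q_neq0 // moebius_fin mul0r add0r ?mulr0 ?add0r ?divr1 ?oner_eq0.
have h1 : (b.+1 + a == 0)%N = false by lia.
have h2 : (b.+1 + a <= a)%N = false by lia.
have h3 : (b.+1 + a - a = b.+1)%N by lia.
rewrite {1}/F; case e: (a + (b.+1 + a))%N => [|m]; first by lia.
rewrite qeuclidS h1 h2 h3 gtn_eqF // qeuclidE //; lia.
Qed.

Let FZ k a b : (0 < k)%N -> F (k * a) (k * b) = F a b.
Proof.
move=> k0; move: {2}(a + b)%N (leqnn (a + b)) => n.
elim: n a b => [|n IH] a b hn.
  have [-> ->] : a = 0%N /\ b = 0%N by lia.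
  by rewrite muln0.
case: (posnP a) => [->|a0]; first by rewrite muln0 !F0.
case: (posnP b) => [->|b0]; first by rewrite muln0 !Finf // muln_gt0 k0.
case: (leqP b a) => h.
  rewrite -(subnK h) mulnDr !FT ?muln_gt0 ?k0 // IH //; lia.
rewrite -(subnK (ltnW h)) mulnDr !FL ?muln_gt0 ?k0 // IH //; lia.
Qed.

Let f0 (x : P1 rat) : P1 K :=
  match x with
  | infty => infty
  | fin r => if 0 <= r then F `|numq r|%N `|denq r|%N
             else moebius Sq (F `|denq r|%N `|numq r|%N)
  end.

Let fracE (a b : nat) : (0 < b)%N -> exists k : nat, [/\ (0 < k)%N,
  a = (k * `|numq (a%:R / b%:R)|)%N & b = (k * `|denq (a%:R / b%:R)|)%N].
Proof.
move=> b0; set r : rat := _ / _.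
have d0 : (0 < `|denq r|)%N by rewrite absz_gt0 denq_eq0.
have r0 : 0 <= r by rewrite divr_ge0 ?ler0n.
have e : (a * `|denq r| = b * `|numq r|)%N.
  apply/eqP; rewrite -(eqr_nat rat) !natrM.
  have -> : (`|denq r|%:R : rat) = (denq r)%:~R.
    by rewrite pmulrn absz_denq.
  have -> : (`|numq r|%:R : rat) = (numq r)%:~R.
    by rewrite pmulrn gez0_abs // numq_ge0.
  rewrite numqE /r mulrA [b%:R * _]mulrC divfK // pnatr_eq0; lia.
have dv : (`|denq r| %| b)%N.
  rewrite -(@Gauss_dvdl _ _ `|numq r|) 1?coprime_sym ?coprime_num_den //.
  by rewrite -e dvdn_mull.
exists (b %/ `|denq r|)%N; split; last by rewrite divnK.
  by rewrite divn_gt0 // dvdn_leq.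
apply/eqP; rewrite -(eqn_pmul2r d0) e; apply/eqP.
by rewrite mulnAC divnK.
Qed.

Let f0_pos (a b : nat) : (0 < b)%N -> f0 (fin (a%:R / b%:R)) = F a b.
Proof.
move=> b0; rewrite /f0 divr_ge0 ?ler0n //.
by have [k [k0 ha hb]] := fracE a b0; rewrite -(FZ _ _ k0) -ha -hb.
Qed.

Let f0_neg (a b : nat) : (0 < a)%N -> (0 < b)%N ->
  f0 (fin (- (a%:R / b%:R))) = moebius Sq (F b a).
Proof.
move=> a0 b0; rewrite /f0 oppr_ge0 leNgt divr_gt0 ?ltr0n //=.
rewrite numqN denqN abszN.
by have [k [k0 ha hb]] := fracE a b0; rewrite -(FZ _ _ k0) -ha -hb.
Qed.

Let P1ratP (x : P1 rat) : [\/ x = infty, x = fin 0,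
   exists a b : nat, [/\ (0 < a)%N, (0 < b)%N & x = fin (a%:R / b%:R)]
 | exists a b : nat, [/\ (0 < a)%N, (0 < b)%N & x = fin (- (a%:R / b%:R))]].
Proof.
case: x => [r|]; last by constructor 1.
have d0 : (0 < `|denq r|)%N by rewrite absz_gt0 denq_eq0.
have de : (`|denq r|%:R : rat) = (denq r)%:~R by rewrite pmulrn absz_denq.
have ne : (`|numq r|%:R : rat) = `|(numq r)%:~R|.
  by rewrite pmulrn abszE intr_norm.
have re : `|r| = `|numq r|%:R / `|denq r|%:R.
  by rewrite ne de -{1}[r]divq_num_den normrM normfV [`|(denq r)%:~R|]ger0_norm
    // ler0z.
have [h | h | ->] := ltrgt0P r; last by constructor 2.
- constructor 3; exists `|numq r|%N, `|denq r|%N; split => //.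
    by rewrite absz_gt0 numq_eq0 gt_eqF.
  by rewrite -re gtr0_norm.
- constructor 4; exists `|numq r|%N, `|denq r|%N; split => //.
    by rewrite absz_gt0 numq_eq0 lt_eqF.
  by rewrite -re ltr0_norm // opprK.
Qed.

Let FL0 a b : F a (b + a) = moebius Lq (F a b).
Proof.
have [->|] := posnP a; last exact: FL.
by rewrite !F0 moebius_fin !mulr0 !add0r ?oner_eq0 ?mul0r.
Qed.

Let TSL x : moebius Tq (moebius Sq (moebius Lq x)) = moebius Sq x.
Proof.
rewrite [moebius Sq (moebius _ _)]moebiusM // moebiusM; last first.
  by rewrite unitmx_mul uSq.
rewrite -(moebiusZ Sq x q_neq0) !mx2M mx2Z; congr (moebius (mx2 _ _ _ _) _); ring.
Qed.

Let TST x : moebius Tq (moebius Sq (moebius Tq x)) = moebius Lq x.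
Proof.
rewrite [moebius Sq (moebius _ _)]moebiusM // moebiusM; last first.
  by rewrite unitmx_mul uSq.
rewrite -(moebiusZ Lq x q_neq0) !mx2M mx2Z; congr (moebius (mx2 _ _ _ _) _); ring.
Qed.

Let Tfin r : moebius T (fin r) = fin (r + 1).
Proof. by rewrite moebius_fin mul0r add0r ?oner_eq0 // divr1 mul1r. Qed.
Let Sfin r : r != 0 -> moebius S (fin r) = fin (- r^-1).
Proof. by move=> r0; rewrite moebius_fin mul1r addr0 // mul0r add0r mulN1r. Qed.
Let S0 : moebius S (fin 0) = infty.
Proof. by rewrite moebius_pole // mulr0 addr0. Qed.
Let Sinf : moebius S infty = fin 0.
Proof. by rewrite moebius_inf oner_eq0 mul0r. Qed.
Let Tinf : moebius T infty = infty.
Proof. by rewrite moebius_inf eqxx. Qed.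
Let Sq0 : moebius Sq (fin 0) = infty.
Proof. by rewrite moebius_pole // mulr0 addr0. Qed.
Let Sqinf : moebius Sq infty = fin 0.
Proof. by rewrite moebius_inf (negPf q_neq0) mul0r. Qed.
Let Tqinf : moebius Tq infty = infty.
Proof. by rewrite moebius_inf eqxx. Qed.

Let f0_0 : f0 (fin 0) = fin 0.
Proof. by rewrite -(F0 1) -f0_pos // mul0r. Qed.

Let frac_neq0 (a b : nat) : (0 < a)%N -> (0 < b)%N -> a%:R / b%:R != 0 :> rat.
Proof. by move=> a0 b0; rewrite gt_eqF // divr_gt0 ?ltr0n. Qed.

Let f0S x : f0 (moebius S x) = moebius Sq (f0 x).
Proof.
have [->|->|[a [b [a0 b0 ->]]]|[a [b [a0 b0 ->]]]] := P1ratP x.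
- by rewrite Sinf f0_0 Sqinf.
- by rewrite S0 f0_0 Sq0.
- by rewrite Sfin ?frac_neq0 // invf_div f0_neg // f0_pos.
- by rewrite Sfin ?oppr_eq0 ?frac_neq0 // invrN opprK invf_div f0_neg // f0_pos // SqK.
Qed.

Let f0T x : f0 (moebius T x) = moebius Tq (f0 x).
Proof.
have [->|->|[a [b [a0 b0 ->]]]|[a [b [a0 b0 ->]]]] := P1ratP x.
- by rewrite Tinf Tqinf.
- by rewrite Tfin f0_0 add0r -(F0 1) -FT // -f0_pos // divr1.
- have bn0 : b%:R != 0 :> rat by rewrite pnatr_eq0; lia.
  have -> : moebius T (fin (a%:R / b%:R)) = fin ((a + b)%:R / b%:R).
    by rewrite Tfin natrD; congr Some; field.
  by rewrite !f0_pos // FT.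
have bn0 : b%:R != 0 :> rat by rewrite pnatr_eq0; lia.
rewrite Tfin f0_neg //; case: (leqP a b) => h.
  rewrite -(subnK h); set d := (b - a)%N.
  have -> : - (a%:R / (d + a)%:R) + 1 = d%:R / (d + a)%:R :> rat.
    by rewrite /d subnK // natrB //; field.
  rewrite f0_pos; last lia.
  by rewrite FT // TST addnC FL0.
rewrite -(subnK (ltnW h)); set e := (a - b)%N.
have -> : - ((e + b)%:R / b%:R) + 1 = - (e%:R / b%:R) :> rat.
  by rewrite natrD; field.
by rewrite f0_neg // ?FL0 ?TSL // subn_gt0.
Qed.

Let f0_uniq g : is_qrational q g -> g =1 f0.
Proof.
move=> [g0 gT gS].
have gpos n a b : (a + b <= n)%N -> (0 < b)%N -> g (fin (a%:R / b%:R)) = F a b.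
  elim: n a b => [|n IH] a b hn b0; first by lia.
  have bn0 : b%:R != 0 :> rat by rewrite pnatr_eq0; lia.
  case: (posnP a) => [->|a0]; first by rewrite mul0r g0 F0.
  have an0 : a%:R != 0 :> rat by rewrite pnatr_eq0; lia.
  case: (leqP b a) => h.
    have -> : fin (a%:R / b%:R) = moebius T (fin ((a - b)%:R / b%:R)).
      by rewrite Tfin natrB //; congr Some; field.
    by rewrite gT IH //; [rewrite -FT // subnK | lia].
  have dn0 : b%:R - a%:R != 0 :> rat by rewrite -natrB 1?ltnW // pnatr_eq0; lia.
  have e : moebius T (moebius S (fin (a%:R / b%:R))) =
           moebius S (fin (a%:R / (b - a)%:R)).
    rewrite !Sfin ?frac_neq0 ?subn_gt0 // Tfin natrB 1?ltnW //; congr Some.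
    by field; rewrite ?an0 ?bn0 ?dn0.
  have := congr1 g e; rewrite gT !gS (IH a (b - a)%N) ?subn_gt0 //; last lia.
  rewrite -[in RHS]TSL => h1; rewrite (moebius_inj uSq (moebius_inj uTq h1)).
  by rewrite -FL0 subnK // ltnW.
move=> x; have [->|->|[a [b [a0 b0 ->]]]|[a [b [a0 b0 ->]]]] := P1ratP x.
- by rewrite -S0 gS g0 Sq0 S0.
- by rewrite g0 f0_0.
- by rewrite f0_pos // (gpos (a + b)%N).
- rewrite f0_neg // -(gpos (b + a)%N) // -gS Sfin ?frac_neq0 //.
  by rewrite invf_div.
Qed.

Lemma qrational_sig :
  {f : P1 rat -> P1 K | is_qrational q f /\ forall g, is_qrational q g -> g =1 f}.
Proof. by exists f0; split=> [|g /f0_uniq]; [split | ]. Qed.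

End QRational.

Definition Qq : fieldType := {fraction {poly rat}}.

Definition q : Qq := tofrac 'X.

Lemma q_neq0 : q != 0.
Proof. by rewrite tofrac_eq0 polyX_eq0. Qed.

(* [x]_q, the unique map satisfying [is_qrational q]. *)
Definition qrat : P1 rat -> P1 Qq := sval (qrational_sig q_neq0).

Lemma qratP : is_qrational q qrat.
Proof. by case: (svalP (qrational_sig q_neq0)). Qed.

Lemma qrat_unique f : is_qrational q f -> f =1 qrat.
Proof. by case: (svalP (qrational_sig q_neq0)) => _; apply. Qed.

Definition quadruple := (4.-tuple (P1 rat))%type.

Definition crq (x : quadruple) : Qq :=
  let y i := qrat (nth infty x i) in cr (y 0%N) (y 1%N) (y 2%N) (y 3%N).

(* A class in PGL(2, Z) acts through either of its lifts to GL(2, Z). *)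
Definition PGL_S4_equiv (x y : quadruple) : Prop :=
  exists (g : 'M[int]_2) (s : 'S_4), g \in unitmx /\
    y = [tuple moebius (map_mx intr g) (tnth x (s i)) | i < 4].

Definition Xquad (n : nat) : quadruple :=
  [tuple fin (- n%:R); fin (- n%:R^-1); fin 1; fin (- 1)].

Definition Yquad : quadruple := [tuple fin (- 1); fin 1; infty; fin 0].

(* Main.v *)
Require Import Defs.
From HB Require Import structures.
From mathcomp Require Import all_boot all_order all_algebra all_fingroup.
From mathcomp Require Import ring zify.

Set Implicit Arguments.
Unset Strict Implicit.
Unset Printing Implicit Defensive.

Import Order.TTheory GRing.Theory Num.Theory.
Local Open Scope ring_scope.

(** The q-cross-ratios follow from [-n]_q = - q^(-n) [n]_q and
    [-1/n]_q = - 1 / (q [n]_q).  At q = 1 all the cross-ratios equal -1, so they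
    do not separate the quadruples.  Instead, write points of P^1(Q) as
    primitive integer vectors, unique up to sign: the absolute values of the
    determinants of pairs are GL(2, Z)-invariant, so their sum over all pairs is
    invariant under PGL(2, Z) and S_4.  It is 7 for Y and n^2 + 4n + 1 for X_n. *)

Lemma cr_fin (K : fieldType) (x1 x2 x3 x4 : K) :
  cr (Some x1) (Some x2) (Some x3) (Some x4) =
  ((x1 - x3) * (x2 - x4)) / ((x1 - x4) * (x2 - x3)).
Proof. by rewrite /cr !DeltaE !mxE /= !mulr1 !mul1r. Qed.

Section QValues.
Variables (K : fieldType) (q : K) (f : P1 rat -> P1 K).
Hypotheses (q0 : q != 0) (fP : is_qrational q f).

Let translate (r : rat) : moebius (mx2 1 1 0 1) (Some r) = Some (r + 1).
Proof. by rewrite moebius_fin mul0r add0r ?oner_eq0 // divr1 mul1r. Qed.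

Lemma qrational_infty : f None = None.
Proof.
have := qrationalS fP (Some 0); rewrite (qrational0 fP).
by rewrite !moebius_pole ?mulr0 ?addr0.
Qed.

Lemma qrational_fin_succ r y : f (Some r) = Some y ->
  f (Some (r + 1)) = Some (q * y + 1).
Proof.
move=> h; rewrite -translate (qrationalT fP) h moebius_fin mul0r add0r.
  by rewrite divr1.
exact: oner_neq0.
Qed.

Lemma qrational_fin_pred r y : f (Some r) = Some y ->
  f (Some (r - 1)) = Some ((y - 1) / q).
Proof.
move=> h; have u : mx2 q 1 0 1 \in unitmx.
  by apply: mx2_unit; rewrite mulr1 mulr0 subr0.
apply: (moebius_inj u); rewrite -(qrationalT fP) translate subrK h.
rewrite moebius_fin mul0r add0r ?oner_neq0 // divr1.
by congr Some; field.
Qed.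

Lemma qrational_fin_oppV r y : r != 0 -> y != 0 -> f (Some r) = Some y ->
  f (Some (- r^-1)) = Some (- (q * y)^-1).
Proof.
move=> r0 y0 h; have <- : moebius (mx2 0 (- 1) 1 0) (Some r) = Some (- r^-1).
  by rewrite moebius_fin mul1r addr0 // mul0r add0r mulN1r.
by rewrite (qrationalS fP) h moebius_fin addr0 ?mulf_neq0 // mul0r add0r mulN1r.
Qed.

(** The $q$-integer $(q^n-1)/(q-1)$, as a sum so that it makes sense at $q=1$. *)
Definition qint (n : nat) : K := \sum_(i < n) q ^+ i.

Lemma qintSl n : qint n.+1 = q * qint n + 1.
Proof.
rewrite /qint big_ord_recl expr0 addrC mulr_sumr; congr (_ + _).
by apply: eq_bigr => i _; rewrite exprS.
Qed.

Lemma qintSr n : qint n.+1 = qint n + q ^+ n.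
Proof. by rewrite /qint big_ord_recr. Qed.

Lemma qrational_nat n : f (Some n%:R) = Some (qint n).
Proof.
elim: n => [|n IHn]; first by rewrite (qrational0 fP) /qint big_ord0.
by rewrite -natr1 (qrational_fin_succ IHn) qintSl.
Qed.

Lemma qrational_oppn n : f (Some (- n%:R)) = Some (- qint n / q ^+ n).
Proof.
elim: n => [|n IHn].
  by rewrite oppr0 (qrational0 fP) /qint big_ord0 oppr0 mul0r.
rewrite -natr1 opprD (qrational_fin_pred IHn) qintSr exprS.
have qn0 : q ^+ n != 0 by rewrite expf_neq0.
by congr Some; field; rewrite q0 qn0.
Qed.

(** [qint n != 0] keeps the image of $-1/n$ finite; the denominator factors [x1 - x4] and [x2 - x3]
    vanish exactly when [qint n = 1] and [qint n.+1 = 0]. *)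
Lemma cr_qrational_X n : n%:R != 0 :> rat -> qint n != 0 -> qint n != 1 ->
  qint n.+1 != 0 ->
  cr (f (Some (- n%:R))) (f (Some (- n%:R^-1))) (f (Some 1)) (f (Some (- 1))) = - q.
Proof.
move=> n0 s0; rewrite -subr_eq0 qintSl => s1 sS.
have q1 : qint 1 = 1 by rewrite /qint big_ord1.
rewrite qrational_oppn (qrational_fin_oppV n0 s0 (qrational_nat n)).
rewrite -[1]/(1%:R) qrational_nat qrational_oppn q1 expr1 cr_fin.
(* Comparing both recursions for [qint n.+1] eliminates the power $q^n$, leaving a rational identity
   in [q] and [s = qint n]. *)
have e : q ^+ n = q * qint n + 1 - qint n by rewrite -qintSl qintSr; ring.
have := expf_neq0 n q0; rewrite {}e.
move: (qint n) s0 s1 sS => s s0 s1 sS Q0.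
field; rewrite s0 q0 Q0 /=; apply/andP; split.
  have -> : -1 + -1 * (q * s) = - (q * s + 1) by ring.
  by rewrite oppr_eq0.
have -> : - s * q + (q * s + 1 - s) = - (s - 1) by ring.
by rewrite oppr_eq0.
Qed.

Lemma cr_qrational_Y :
  cr (f (Some (- 1))) (f (Some 1)) (f None) (f (Some 0)) = - q.
Proof.
rewrite qrational_infty (qrational0 fP).
rewrite -[1]/(1%:R) qrational_nat qrational_oppn.
rewrite /qint big_ord1 expr0 expr1 /cr !DeltaE !mxE /=.
by field; rewrite q0 oner_neq0.
Qed.

End QValues.

(** The powers of the indeterminate have distinct degrees. *)
Lemma expq_inj : injective (fun n => q ^+ n).
Proof.
move=> m n /eqP; rewrite /q -!tofracXn tofrac_eq => /eqP e.
by have := congr1 (fun p : {poly rat} => size p) e; rewrite !size_polyXn => -[].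
Qed.

Lemma qint_inj : injective (qint q).
Proof.
move=> m n h; apply: expq_inj => /=.
suff E k : q ^+ k = (q - 1) * qint q k + 1 by rewrite !E h.
have := qintSr q k; rewrite qintSl => e.
have -> : q ^+ k = qint q k + q ^+ k - qint q k by ring.
by rewrite -e; ring.
Qed.

Lemma crq_X n : (2 <= n)%N -> crq (Xquad n) = - q.
Proof.
move=> n2; have qint0 : qint q 0 = 0 by rewrite /qint big_ord0.
have qint1 : qint q 1 = 1 by rewrite /qint big_ord1.
(* Reading 0 and 1 as [qint q 0] and [qint q 1] turns every side condition on [qint] into an
   instance of injectivity. *)
apply: (cr_qrational_X q_neq0 qratP); rewrite ?pnatr_eq0 -?qint0 -?qint1;
  try (by lia); by apply/eqP => /qint_inj; lia.
Qed.

Lemma crq_Y : crq Yquad = - q.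
Proof. exact: (cr_qrational_Y q_neq0 qratP). Qed.

(* Coordinates of a primitive integer vector representing a point. *)
Definition pnum (x : P1 rat) : int := if x is Some r then numq r else 1.
Definition pden (x : P1 rat) : int := if x is Some r then denq r else 0.

Definition idet (x y : P1 rat) : nat := absz (pnum x * pden y - pden x * pnum y)%R.

Definition intvec (a b : int) : 'cV[rat]_2 := vec2 a%:~R b%:~R.

Lemma lift_pt_prim x : exists2 c : rat,
  c != 0 & intvec (pnum x) (pden x) = c *: lift_pt x.
Proof.
case: x => [r|]; last by exists 1; rewrite ?oner_neq0 ?scale1r.
exists (denq r)%:~R; first by rewrite intr_eq0 denq_neq0.
by apply: vecP; rewrite !mxE /= ?mulr1 // mulrC numqE.
Qed.

(** [k] is, up to sign, the common factor cancelled in $a/b$; the zero vector is covered by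
    $k=0$. *)
Lemma pt_of_intvec a b : exists k : int,
  a = k * pnum (pt_of (intvec a b)) /\ b = k * pden (pt_of (intvec a b)).
Proof.
rewrite /pt_of !mxE /= intr_eq0; case: eqP => [->|b0].
  by exists a; rewrite mulr1 mulr0.
by case: divqP b0 => // k r k0 _; exists k.
Qed.

Lemma moebius_prim (g : 'M[int]_2) x : exists k : int, let y := moebius (map_mx intr g) x in
  g 0 0 * pnum x + g 0 1 * pden x = k * pnum y /\
  g 1 0 * pnum x + g 1 1 * pden x = k * pden y.
Proof.
have [c c0 e] := lift_pt_prim x.
(* Rescaling the lift of [x] by [c] makes it the primitive integer vector. *)
rewrite /moebius /= -(pt_ofZ _ c0) scalemxAr -e.
set v := _ *m _; suff -> : v = intvec (g 0 0 * pnum x + g 0 1 * pden x)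
  (g 1 0 * pnum x + g 1 1 * pden x) by apply: pt_of_intvec.
apply: vecP; rewrite /v !mxE !big_ord_recl big_ord0 !mxE /= addr0 -!intrM -intrD;
 by do ![congr (_ + _) | congr (_ * _) | congr (g _ _) | congr (_ %:~R)]; apply: val_inj.
Qed.

Lemma det_unit_int (g : 'M[int]_2) : g \in unitmx ->
  absz (g 0 0 * g 1 1 - g 0 1 * g 1 0)%R = 1%N.
Proof.
rewrite unitmxE => u; suff <- : \det g = g 0 0 * g 1 1 - g 0 1 * g 1 0.
  have /eqP := congr1 absz (mulrV u).
  by rewrite abszM muln_eq1 => /andP[/eqP].
(* [det_mx2] is stated over a field, so the identity is checked in [rat]. *)
apply: (@intr_inj rat); rewrite -det_map_mx det_mx2 !mxE.
by rewrite intrB !intrM.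
Qed.

(* Divisibility avoids proving that [g] preserves primitivity: applying it to
   [invmx g] as well gives equality. *)
Lemma idet_moebius_dvd (g : 'M[int]_2) x y : g \in unitmx ->
  (idet (moebius (map_mx intr g) x) (moebius (map_mx intr g) y) %| idet x y)%N.
Proof.
move=> /det_unit_int u.
have [k [/= e1 e2]] := moebius_prim g x.
have [l [/= e3 e4]] := moebius_prim g y.
(* From $\det(gu,gv)=\det g\cdot\det(u,v)$ with $|\det g|=1$; [k] and [l] are the factors split off
   from $gu$ and $gv$. *)
apply/dvdnP; exists (absz (k * l)%R).
rewrite -[LHS]mul1n -[in LHS]u /idet -!abszM; congr absz.
set X := moebius _ x in e1 e2 *; set Y := moebius _ y in e3 e4 *.
transitivity ((k * pnum X) * (l * pden Y) - (k * pden X) * (l * pnum Y)); last by ring.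
by rewrite -e1 -e2 -e3 -e4; ring.
Qed.

Lemma idet_moebius (g : 'M[int]_2) x y : g \in unitmx ->
  idet (moebius (map_mx intr g) x) (moebius (map_mx intr g) y) = idet x y.
Proof.
move=> u; have gK : map_mx intr (invmx g) *m map_mx intr g = 1%:M :> 'M[rat]_2.
  by rewrite -map_mxM mulVmx // map_mx1.
have [_ ug] := mulmx1_unit gK.
have uK (z : P1 rat) :
    moebius (map_mx intr (invmx g)) (moebius (map_mx intr g) z) = z.
  by rewrite moebiusM // gK /moebius mul1mx lift_ptK.
apply/eqP; rewrite eqn_dvd idet_moebius_dvd //.
rewrite -{1}[x]uK -{1}[y]uK; apply: idet_moebius_dvd; by rewrite unitmx_inv.
Qed.

(* Ordered pairs: twice the sum over unordered pairs. *)
Definition idet_sum (x : quadruple) : nat :=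
  (\sum_(i < 4) \sum_(j < 4) idet (tnth x i) (tnth x j))%N.

(** The permutation merely reindexes both sums, and each term is invariant under [g]. *)
Lemma idet_sum_equiv x y : PGL_S4_equiv x y -> idet_sum x = idet_sum y.
Proof.
move=> [g [s [u ->]]]; rewrite /idet_sum (reindex_perm s); apply: eq_bigr => i _.
rewrite (reindex_perm s); apply: eq_bigr => j _.
by rewrite !tnth_mktuple idet_moebius.
Qed.

Lemma pnum_oppV n : (0 < n)%N ->
  pnum (Some (- n%:R^-1)) = -1 /\ pden (Some (- n%:R^-1)) = n%:Z.
Proof.
move=> n0; rewrite /= numqN denqN -[_^-1]mul1r -[1]/(1%:~R) -[n%:R]/(n%:~R).
rewrite coprimeq_num ?coprime1n // coprimeq_den ?coprime1n //.
rewrite gtr0_sg ?mul1r //; split=> //; case: eqP => [|_]; lia.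
Qed.

Lemma pnum_oppn n :
  pnum (Some (- n%:R)) = - n%:Z /\ pden (Some (- n%:R)) = 1.
Proof. by rewrite /= numqN denqN -[n%:R]/(n%:~R) numq_int denq_int. Qed.

(** The vectors $(-n,1),(-1,n),(1,1),(-1,1)$ have absolute determinants $n^2-1$, $n+1$ twice, $n-1$
    twice, and 2. *)
Lemma idet_sum_X n : (2 <= n)%N -> idet_sum (Xquad n) = (2 * (n ^ 2 + 4 * n + 1))%N.
Proof.
move=> n2; have [|e1 e2] := @pnum_oppV n; first by lia.
have [e3 e4] := pnum_oppn n; have [e5 e6] := pnum_oppn 1.
have [e7 e8] : pnum (Some 1) = 1 /\ pden (Some 1) = 1 by [].
rewrite /idet_sum !big_ord_recl !big_ord0 !(tnth_nth None) /= /idet.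
rewrite e1 e2 e3 e4 e5 e6 e7 e8.
(* With [n * n] treated as an atom by [lia], this bound fixes the sign of $n^2-1$. *)
have nn : (n <= n * n)%N by rewrite leq_pmulr; lia.
have -> : (n ^ 2 = n * n)%N by [].
lia.
Qed.

Lemma idet_sum_Y : idet_sum Yquad = 14%N.
Proof.
by rewrite /idet_sum !big_ord_recl !big_ord0 /= !(tnth_nth None).
Qed.

Theorem proposition5p3 :
  (forall n : nat, (2 <= n)%N -> crq (Xquad n) = - q /\ crq Yquad = - q) /\
  (forall n : nat, (2 <= n)%N -> ~ PGL_S4_equiv Yquad (Xquad n)) /\
  (forall m n : nat, (2 <= m)%N -> (2 <= n)%N -> m <> n ->
     ~ PGL_S4_equiv (Xquad m) (Xquad n)).
Proof.
split; first by move=> n n2; rewrite crq_X // crq_Y.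
split=> [n n2|m n m2 n2 mn] /idet_sum_equiv.
  (* For $n\ge2$ the right side is at least 26, above 14. *)
  by rewrite idet_sum_Y idet_sum_X //; nia.
(* $n^2+4n+1$ is strictly increasing in $n$. *)
by rewrite !idet_sum_X //; nia.
Qed.
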